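(* Let $\mathbf{X}=(X,d,A,\alpha)$ and $\mathbf{Y}=(Y,e,B,\beta)$ be effective metric spaces, let $D\subseteq X$ and $\theta:D\to Y$. Suppose $S$ is an $A,B$-approximation system for $\theta$ which is recursively enumerable with respect to $\alpha$ and $\beta$. Then $\theta$ is $(\delta_\mathbf{X},\delta_\mathbf{Y})$-computable.
   Context: Here $\mathbb{N}=\{0,1,2,\dots\}$. An effective metric space $\mathbf{X}=(X,d,A,\alpha)$ consists of a metric space $(X,d)$ (not necessarily complete, with no effectivity requirement on $d$), a countable dense subset $A\subseteq X$, and a notation $\alpha$ of $A$, regarded here as a surjective map from some subset $\mathrm{dom}(\alpha)\subseteq\mathbb{N}$ onto $A$; similarly for $\mathbf{Y}=(Y,e,B,\beta)$. A Cauchy name of $\xi\in X$ is a total function $f:\mathbb{N}\to\mathbb{N}$ with $f(i)\in\mathrm{dom}(\alpha)$ for all $i$, $d(\alpha(f(i)),\alpha(f(k)))\le 2^{-i}$ for all $i<k$, and $\xi=\lim_{i\to\infty}\alpha(f(i))$ ($\delta_\mathbf{X}$ denotes the resulting Cauchy representation; similarly $\delta_\mathbf{Y}$ for $Y$ via $\beta$). The function $\theta$ is $(\delta_\mathbf{X},\delta_\mathbf{Y})$-computable if there is a recursive (computable) operator $T$ mapping unary partial functions on $\mathbb{N}$ to unary partial functions on $\mathbb{N}$ such that whenever $f$ is a Cauchy name of some $\xi\in D$, $T(f)$ is a Cauchy name of $\theta(\xi)$. An $A,B$-approximation system for $\theta$ is a set $S\subseteq A\times\mathbb{N}\times B\times\mathbb{N}$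 such that for every $\xi\in D$: (1) whenever $(a,m,b,n)\in S$ and $d(a,\xi)<\frac{1}{m+1}$, then $e(b,\theta(\xi))<\frac{1}{n+1}$; (2) for every $n\in\mathbb{N}$ there exists $m\in\mathbb{N}$ such that for every $a\in A$ with $d(a,\xi)<\frac{1}{m+1}$ there is some $b$ with $(a,m,b,n)\in S$. The set $S$ is recursively enumerable with respect to $\alpha$ and $\beta$ if $\hat S=\{(i,m,j,n)\mid i\in\mathrm{dom}(\alpha),\ j\in\mathrm{dom}(\beta),\ (\alpha(i),m,\beta(j),n)\in S\}$ is a recursively enumerable subset of $\mathbb{N}^4$. *)

(* Defs.v *)
From HB Require Import structures.
From mathcomp Require Import all_boot all_order all_algebra.
From mathcomp Require Import all_classical all_reals all_analysis.

Set Implicit Arguments.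
Unset Strict Implicit.
Unset Printing Implicit Defensive.

Import Order.TTheory GRing.Theory Num.Theory.
Import numFieldNormedType.Exports.

Local Open Scope classical_set_scope.

(* The total recursive functions: the least class containing the initial
   functions and closed under substitution, primitive recursion, and
   minimization of functions that have a zero in every fibre. *)
Inductive recursive : forall n : nat, (n.-tuple nat -> nat) -> Prop :=
| recursive_zero n : recursive (fun _ : n.-tuple nat => 0%N)
| recursive_succ : recursive (fun v : 1.-tuple nat => (thead v).+1)
| recursive_proj n (i : 'I_n) : recursive (fun v : n.-tuple nat => tnth v i)
| recursive_comp m n (g : m.-tuple nat -> nat)
    (h : 'I_m -> n.-tuple nat -> nat) :
    recursive g -> (forall i, recursive (h i)) ->
    recursive (fun v : n.-tuple nat => g [tuple h i v | i < m])
| recursive_primrec n (g : n.-tuple nat -> nat) (h : n.+2.-tuple nat -> nat)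
    (f : n.+1.-tuple nat -> nat) :
    recursive g -> recursive h ->
    (forall v : n.-tuple nat, f [tuple of 0%N :: v] = g v) ->
    (forall (k : nat) (v : n.-tuple nat),
       f [tuple of k.+1 :: v] = h [tuple of k :: f [tuple of k :: v] :: v]) ->
    recursive f
| recursive_min n (g : n.+1.-tuple nat -> nat) (f : n.-tuple nat -> nat) :
    recursive g ->
    (forall v : n.-tuple nat, g [tuple of f v :: v] = 0%N) ->
    (forall (v : n.-tuple nat) (k : nat),
       (k < f v)%N -> g [tuple of k :: v] <> 0%N) ->
    recursive f.

(* A subset of N^n is recursively enumerable if it is empty or is the range of
   a recursive function from N to N^n, given here by its components. *)
Definition recursively_enumerable (n : nat) (P : set (n.-tuple nat)) : Prop :=
  P = set0 \/
  exists2 h : 'I_n -> 1.-tuple nat -> nat,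
    (forall i, recursive (h i)) &
    P = range (fun t : nat => [tuple h i [tuple t] | i < n]).

(* [None] means "undefined". *)
Definition partial_function := nat -> option nat.

(* Cantor's bijection from N^2 to N. *)
Definition cantor_pair (x y : nat) : nat := (((x + y) * (x + y).+1)./2 + y)%N.

(* The finite set with canonical index [u]: the positions of the digit 1 in
   the binary expansion of [u]. *)
Definition canonical_finite_set (u : nat) : set nat :=
  [set z | odd (u %/ 2 ^ z)].

Definition coded_graph (f : partial_function) : set nat :=
  [set z | exists x y, f x = Some y /\ z = cantor_pair x y].

(* A recursive operator is an enumeration operator that maps (graphs of)
   partial functions to (graphs of) partial functions. *)
Definition recursive_operator (T : partial_function -> partial_function)
    : Prop :=
  exists2 W : set (3.-tuple nat), recursively_enumerable W &
    forall (f : partial_function) (x y : nat),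
      T f x = Some y <->
      exists2 u : nat, W [tuple u; x; y] &
        canonical_finite_set u `<=` coded_graph f.

Local Open Scope ring_scope.

(* The notation of the dense set is a map from a subset of N: its domain is
   the set of [i] with [ems_notation i <> None]. *)
Record effective_metric_space (R : realType) := EffectiveMetricSpace {
  ems_carrier :> metricType R ;
  ems_set : set ems_carrier ;
  ems_notation : nat -> option ems_carrier ;
  ems_countable : countable ems_set ;
  ems_dense : dense ems_set ;
  ems_notation_onto :
    forall a, ems_set a <-> exists i : nat, ems_notation i = Some a
}.

Definition cauchy_name (R : realType) (X : effective_metric_space R)
    (xi : X) (f : nat -> nat) : Prop :=
  exists x : nat -> X,
    [/\ forall i : nat, ems_notation X (f i) = Some (x i),
        forall i k : nat, (i < k)%N -> mdist (x i) (x k) <= 2 ^- i &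
        x i @[i --> \oo] --> xi].

Definition computable (R : realType) (X Y : effective_metric_space R)
    (D : set X) (theta : D -> Y) : Prop :=
  exists2 T : partial_function -> partial_function, recursive_operator T &
    forall (xi : D) (f : nat -> nat), cauchy_name (val xi) f ->
      exists2 g : nat -> nat,
        (forall i, T (fun j => Some (f j)) i = Some (g i)) &
        cauchy_name (theta xi) g.

Definition approximation_system (R : realType)
    (X Y : effective_metric_space R) (D : set X) (theta : D -> Y)
    (S : set (X * nat * Y * nat)) : Prop :=
  (forall a m b n, S (a, m, b, n) -> ems_set a /\ ems_set b) /\
  forall xi : D,
    (forall a m b n, S (a, m, b, n) ->
       mdist a (val xi) < m.+1%:R^-1 -> mdist b (theta xi) < n.+1%:R^-1) /\
    (forall n : nat, exists m : nat, forall a : X, ems_set a ->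
       mdist a (val xi) < m.+1%:R^-1 -> exists b : Y, S (a, m, b, n)).

Definition approximation_codes (R : realType)
    (X Y : effective_metric_space R) (S : set (X * nat * Y * nat))
    : set (4.-tuple nat) :=
  [set v | exists i m j n : nat, exists a b,
     [/\ v = [tuple i; m; j; n], ems_notation X i = Some a,
         ems_notation Y j = Some b & S (a, m, b, n)]].

(* Main.v *)
(* Enumerate S-hat as (i_t, m_t, j_t, n_t). On a Cauchy name f and an argument
   x, the operator returns j_t for the least t with i_t = f(m_t + 1) and
   n_t + 1 = 2^(x+1). Since alpha(f(m+1)) lies within 2^-(m+1) < 1/(m+1) of xi,
   condition (2) makes the search succeed and condition (1) puts the output
   within 2^-(x+1) of theta(xi), so the outputs form a Cauchy name. *)
Require Import Defs.
From mathcomp Require Import all_boot all_order all_algebra.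
From mathcomp Require Import all_classical all_reals all_analysis.
From mathcomp Require Import zify ring.

(** * Closure of the total recursive functions under arithmetic, boolean connectives and bounded
    quantifiers *)

Section RecursiveClosure.
Set Implicit Arguments.
Unset Strict Implicit.
Unset Printing Implicit Defensive.
Local Open Scope nat_scope.

Lemma eq_recursive n (f g : n.-tuple nat -> nat) :
  f =1 g -> recursive f -> recursive g.
Proof. by move=> /funext ->. Qed.

Lemma recursive_subst m n (f : m.-tuple nat -> nat)
    (s : n.-tuple nat -> m.-tuple nat) :
  recursive f -> (forall i, recursive (fun v => tnth (s v) i)) ->
  recursive (fun v => f (s v)).
Proof.
move=> rf rs; apply: eq_recursive (recursive_comp rf rs) => v.
by congr f; apply: eq_from_tnth => i; rewrite tnth_mktuple.
Qed.

(** Substitution into a distinguished first argument: it lets the tuple-based schemes serve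
    functions with one argument written apart from the parameters. *)
Lemma recursive_cons n (f : nat -> n.-tuple nat -> nat)
    (a : n.-tuple nat -> nat) :
  recursive (fun w : n.+1.-tuple nat => f (thead w) [tuple of behead w]) ->
  recursive a -> recursive (fun v => f (a v) v).
Proof.
move=> rf ra.
apply: eq_recursive (recursive_subst (s := fun v => [tuple of a v :: v]) rf _).
  by move=> v; congr f; apply: val_inj.
move=> i; case: (unliftP ord0 i) => [j|] ->.
  by apply: eq_recursive (recursive_proj j) => v; rewrite tnthS.
by apply: eq_recursive ra => v; rewrite tnth0.
Qed.

Lemma recursive_app n (f : 1.-tuple nat -> nat) (a : n.-tuple nat -> nat) :
  recursive f -> recursive a -> recursive (fun v => f [tuple a v]).
Proof.
move=> rf ra; apply: recursive_subst rf _ => i.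
by apply: eq_recursive ra => v; rewrite ord1 tnth0.
Qed.

Lemma recursive_thead n : recursive (fun w : n.+1.-tuple nat => thead w).
Proof. exact: recursive_proj. Qed.

Lemma recursive_behead n (f : n.-tuple nat -> nat) :
  recursive f -> recursive (fun w : n.+1.-tuple nat => f [tuple of behead w]).
Proof.
move=> rf; apply: recursive_subst rf _ => i.
apply: eq_recursive (recursive_proj (lift ord0 i)) => w.
by rewrite [in LHS](tuple_eta w) tnthS.
Qed.

Lemma recursive_S n (a : n.-tuple nat -> nat) :
  recursive a -> recursive (fun v => (a v).+1).
Proof. exact: recursive_app recursive_succ. Qed.

Lemma recursive_const n c : recursive (fun _ : n.-tuple nat => c).
Proof.
by elim: c => [|c IH]; [exact: recursive_zero | exact: recursive_S].
Qed.

(** Curried primitive recursion with a recursive depth [a]; the arguments of [h] are the counter,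
    the previous value and the parameters. *)
Lemma recursive_nat_rec n (g a : n.-tuple nat -> nat)
    (h : nat -> nat -> n.-tuple nat -> nat) (f : nat -> n.-tuple nat -> nat) :
  recursive g ->
  recursive (fun w : n.+2.-tuple nat =>
    h (thead w) (thead [tuple of behead w])
      [tuple of behead [tuple of behead w]]) ->
  (forall v, f 0 v = g v) -> (forall k v, f k.+1 v = h k (f k v) v) ->
  recursive a -> recursive (fun v => f (a v) v).
Proof.
move=> rg rh f0 fS; apply: recursive_cons.
apply: recursive_primrec rg rh _ _ => [v|k v].
  by rewrite theadE -f0; congr f; apply: val_inj.
rewrite [LHS]fS.
have tK j : [tuple of behead [tuple of j :: v]] = v by apply: val_inj.
rewrite tK; congr h; last exact: val_inj.
by rewrite -[in LHS](tK k).
Qed.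

Lemma recursive_add n (a b : n.-tuple nat -> nat) :
  recursive a -> recursive b -> recursive (fun v => a v + b v).
Proof.
move=> ra rb; apply: (recursive_nat_rec (f := fun k v => k + b v)
  (h := fun _ r _ => r.+1) rb _ _ _ ra) => //.
exact: recursive_S (recursive_behead (recursive_thead _)).
Qed.

Lemma recursive_mul n (a b : n.-tuple nat -> nat) :
  recursive a -> recursive b -> recursive (fun v => a v * b v).
Proof.
move=> ra rb; apply: (recursive_nat_rec (f := fun k v => k * b v)
  (h := fun _ r v => b v + r) (recursive_zero n) _ _ _ ra) => //.
apply: recursive_add; first exact: recursive_behead (recursive_behead rb).
exact: recursive_behead (recursive_thead _).
Qed.

Lemma recursive_pred n (a : n.-tuple nat -> nat) :
  recursive a -> recursive (fun v => (a v).-1).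
Proof.
move=> ra; apply: (recursive_nat_rec (f := fun k _ => k.-1)
  (h := fun k _ _ => k) (recursive_zero n) _ _ _ ra) => //.
exact: recursive_thead.
Qed.

(** Truncated subtraction is iterated predecessor, so the recursion runs on the subtrahend. *)
Lemma recursive_sub n (a b : n.-tuple nat -> nat) :
  recursive a -> recursive b -> recursive (fun v => a v - b v).
Proof.
move=> ra rb; apply: (recursive_nat_rec (f := fun k v => a v - k)
  (h := fun _ r _ => r.-1) ra _ _ _ rb) => [|v|k v]; last by rewrite subnS.
  exact: recursive_pred (recursive_behead (recursive_thead _)).
by rewrite subn0.
Qed.

Lemma recursive_exp2 n (a : n.-tuple nat -> nat) :
  recursive a -> recursive (fun v => 2 ^ a v).
Proof.
move=> ra; apply: (recursive_nat_rec (f := fun k _ => 2 ^ k)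
  (h := fun _ r _ => r + r) (recursive_const n 1) _ _ _ ra) => //.
  by apply: recursive_add; exact: recursive_behead (recursive_thead _).
by move=> k _; rewrite expnS mul2n addnn.
Qed.

Lemma recursive_negb n (p : n.-tuple nat -> bool) :
  recursive (fun v => p v : nat) -> recursive (fun v => ~~ p v : nat).
Proof.
move=> rp; apply: eq_recursive (recursive_sub (recursive_const n 1) rp) => v.
by case: (p v).
Qed.

Lemma recursive_andb n (p q : n.-tuple nat -> bool) :
  recursive (fun v => p v : nat) -> recursive (fun v => q v : nat) ->
  recursive (fun v => p v && q v : nat).
Proof.
by move=> rp rq; apply: eq_recursive (recursive_mul rp rq) => v; rewrite mulnb.
Qed.

Lemma recursive_orb n (p q : n.-tuple nat -> bool) :
  recursive (fun v => p v : nat) -> recursive (fun v => q v : nat) ->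
  recursive (fun v => p v || q v : nat).
Proof.
move=> /recursive_negb rp /recursive_negb rq.
apply: eq_recursive (recursive_negb (recursive_andb rp rq)) => v.
by rewrite negb_and !negbK.
Qed.

(** With truncated subtraction, [(a - b) + (b - a)] vanishes exactly at equality. *)
Lemma recursive_eqn n (a b : n.-tuple nat -> nat) :
  recursive a -> recursive b -> recursive (fun v => a v == b v : nat).
Proof.
move=> ra rb; apply: eq_recursive (recursive_sub (recursive_const n 1)
  (recursive_add (recursive_sub ra rb) (recursive_sub rb ra))) => v.
by case: eqP; lia.
Qed.

Lemma recursive_if n (p : n.-tuple nat -> bool) (a b : n.-tuple nat -> nat) :
  recursive (fun v => p v : nat) -> recursive a -> recursive b ->
  recursive (fun v => if p v then a v else b v).
Proof.
move=> rp ra rb; apply: eq_recursive (recursive_add (recursive_mul rp ra)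
  (recursive_mul (recursive_negb rp) rb)) => v.
by case: (p v); rewrite /= ?mul0n ?mul1n ?addn0.
Qed.

Lemma recursive_odd n (a : n.-tuple nat -> nat) :
  recursive a -> recursive (fun v => odd (a v) : nat).
Proof.
move=> ra; apply: (recursive_nat_rec (f := fun k _ => odd k : nat)
  (h := fun _ r _ => 1 - r) (recursive_zero n) _ _ _ ra) => //.
  apply: recursive_sub; first exact: recursive_const.
  exact: recursive_behead (recursive_thead _).
by move=> k _ /=; case: (odd k).
Qed.

Lemma recursive_half n (a : n.-tuple nat -> nat) :
  recursive a -> recursive (fun v => (a v)./2).
Proof.
move=> ra; apply: (recursive_nat_rec (f := fun k _ => k./2)
  (h := fun k r _ => odd k + r) (recursive_zero n) _ _ _ ra) => //.
  apply: recursive_add; first exact: recursive_odd (recursive_thead _).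
  exact: recursive_behead (recursive_thead _).
by move=> k _; rewrite -uphalf_half.
Qed.

(** Halving [b] times brings the digit to the front; this decides membership in the finite set with
    canonical index [a]. *)
Lemma recursive_bit n (a b : n.-tuple nat -> nat) :
  recursive a -> recursive b -> recursive (fun v => odd (a v %/ 2 ^ b v) : nat).
Proof.
move=> ra rb; apply: recursive_odd.
apply: (recursive_nat_rec (f := fun k v => a v %/ 2 ^ k)
  (h := fun _ r _ => r./2) ra _ _ _ rb) => [|v|k v].
- exact: recursive_half (recursive_behead (recursive_thead _)).
- by rewrite divn1.
- by rewrite expnSr divnMA divn2.
Qed.

Lemma recursive_cantor_pair n (a b : n.-tuple nat -> nat) :
  recursive a -> recursive b -> recursive (fun v => cantor_pair (a v) (b v)).
Proof.
move=> ra rb; apply: recursive_add (rb); apply: recursive_half.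
have rs := recursive_add ra rb.
exact/(recursive_mul rs)/recursive_S.
Qed.

Lemma recursive_all n (p : nat -> n.-tuple nat -> bool)
    (a : n.-tuple nat -> nat) :
  recursive (fun w : n.+1.-tuple nat =>
    p (thead w) [tuple of behead w] : nat) ->
  recursive a -> recursive (fun v => all (p ^~ v) (iota 0 (a v)) : nat).
Proof.
move=> rp ra.
apply: (recursive_nat_rec (f := fun k v => all (p ^~ v) (iota 0 k) : nat)
  (h := fun k r v => r * p k v) (recursive_const n 1) _ _ _ ra) => //.
  apply: recursive_mul; first exact: recursive_behead (recursive_thead _).
  (* The predicate reads the counter and the parameters; a substitution removes the accumulated
     value standing between them. *)
  apply: eq_recursive (recursive_subst (s := fun w : n.+2.-tuple nat =>
    [tuple of thead w :: [tuple of behead [tuple of behead w]]]) rp _).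
    by move=> w; rewrite theadE; congr (nat_of_bool (p _ _)); apply: val_inj.
  move=> i; case: (unliftP ord0 i) => [j|] ->.
    apply: eq_recursive (recursive_behead (recursive_behead
      (recursive_proj j))) => w.
    by rewrite tnthS.
  by apply: eq_recursive (recursive_thead n.+1) => w; rewrite tnth0.
by move=> k v; rewrite -addn1 iotaD all_cat /= andbT mulnb.
Qed.

Lemma recursive_has n (p : nat -> n.-tuple nat -> bool)
    (a : n.-tuple nat -> nat) :
  recursive (fun w : n.+1.-tuple nat =>
    p (thead w) [tuple of behead w] : nat) ->
  recursive a -> recursive (fun v => has (p ^~ v) (iota 0 (a v)) : nat).
Proof.
move=> /recursive_negb rp ra.
apply: eq_recursive (recursive_negb
  (recursive_all (p := fun k v => ~~ p k v) rp ra)) => v.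
by rewrite -has_predC; congr nat_of_bool; apply: eq_has => k /=; rewrite negbK.
Qed.

(** * Recursive inverses of the Cantor pairing, through triangular numbers *)

Lemma triangular_le a b : a <= b -> (a * a.+1)./2 <= (b * b.+1)./2.
Proof. by move=> ab; apply/half_leq/leq_mul. Qed.

Lemma triangular_S a : (a.+1 * a.+2)./2 = (a * a.+1)./2 + a.+1.
Proof.
have -> : a.+1 * a.+2 = a * a.+1 + a.+1.*2 by rewrite -muln2; lia.
by rewrite halfD doubleK odd_double andbF.
Qed.

Fact triangular_gt_ex w : exists r, w < (r.+1 * r.+2)./2.
Proof. by exists w; rewrite triangular_S; lia. Qed.

(** The index of the antidiagonal containing [w]: the last [r] whose triangular number is at most
    [w]. The form as a least witness suits [recursive_min]. *)
Definition cantor_sum w := ex_minn (triangular_gt_ex w).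
Definition cantor_snd w := w - (cantor_sum w * (cantor_sum w).+1)./2.
Definition cantor_fst w := cantor_sum w - cantor_snd w.

(** The offset [y] is at most [x + y], so the code stays below the next triangular number. *)
Lemma cantor_pair_sumK x y : cantor_sum (cantor_pair x y) = x + y.
Proof.
rewrite /cantor_sum; case: ex_minnP => r; rewrite /cantor_pair => wr min_r.
apply/eqP; rewrite eqn_leq min_r ?triangular_S; last by lia.
by rewrite leqNgt; apply/negP => /triangular_le; lia.
Qed.

Lemma cantor_pair_sndK x y : cantor_snd (cantor_pair x y) = y.
Proof. by rewrite /cantor_snd cantor_pair_sumK /cantor_pair addKn. Qed.

Lemma cantor_pair_fstK x y : cantor_fst (cantor_pair x y) = x.
Proof. by rewrite /cantor_fst cantor_pair_sumK cantor_pair_sndK addnK. Qed.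

Lemma cantor_pairK w : cantor_pair (cantor_fst w) (cantor_snd w) = w.
Proof.
rewrite /cantor_fst /cantor_snd /cantor_sum; case: ex_minnP => r wr min_r.
(* Minimality of [r], tested at its predecessor, gives the lower bound; [r = 0] is trivial. *)
have rw : (r * r.+1)./2 <= w.
  case: r {wr} min_r => [//|r] min_r; rewrite leqNgt.
  by apply/negP => /min_r; rewrite ltnn.
rewrite /cantor_pair subnK; first by rewrite addnC subnK.
by move: wr; rewrite triangular_S; lia.
Qed.

(** The strict bound defining [cantor_sum] is the vanishing of a truncated difference with
    [(a v).+1], to which minimization applies. *)
Lemma recursive_cantor_sum n (a : n.-tuple nat -> nat) :
  recursive a -> recursive (fun v => cantor_sum (a v)).
Proof.
move=> ra; pose t (w : n.+1.-tuple nat) := (thead w).+1.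
have rt : recursive t by exact: recursive_S (recursive_thead _).
apply: (recursive_min (recursive_sub
  (recursive_S (recursive_behead ra))
  (recursive_half (recursive_mul rt (recursive_S rt))))) => [v|v k].
all: rewrite /t theadE.
all: have -> : [tuple of behead [tuple of _ :: v]] = v by move=> *; apply: val_inj.
all: rewrite /cantor_sum; case: ex_minnP => r wr min_r.
  by apply/eqP; rewrite subn_eq0.
move=> kr /eqP; rewrite subn_eq0 => /min_r; lia.
Qed.

Lemma recursive_cantor_snd n (a : n.-tuple nat -> nat) :
  recursive a -> recursive (fun v => cantor_snd (a v)).
Proof.
move=> ra; have rs := recursive_cantor_sum ra.
exact/(recursive_sub ra)/recursive_half/(recursive_mul rs)/recursive_S.
Qed.

Lemma recursive_cantor_fst n (a : n.-tuple nat -> nat) :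
  recursive a -> recursive (fun v => cantor_fst (a v)).
Proof.
move=> ra; apply: recursive_sub; first exact: recursive_cantor_sum.
exact: recursive_cantor_snd.
Qed.

End RecursiveClosure.

(** * A recursive operator performing an unbounded search relative to an oracle *)

Section OracleSearch.
Set Implicit Arguments.
Unset Strict Implicit.
Unset Printing Implicit Defensive.
Local Open Scope nat_scope.
Local Open Scope classical_set_scope.

(** A nonempty enumerable set must be the range of a total function, so inputs rejected by [C] are
    sent to the output at a fixed accepted [w0]. *)
Lemma recursively_enumerable_image n (C : nat -> bool)
    (o : 'I_n -> nat -> nat) :
  recursive (fun v : 1.-tuple nat => C (thead v) : nat) ->
  (forall i, recursive (fun v : 1.-tuple nat => o i (thead v))) ->
  recursively_enumerable [set v | exists2 w, C w & v = [tuple o i w | i < n]].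
Proof.
move=> rC ro; have [[w0 Cw0]|C0] := pselect (exists w, C w); last first.
  by left; rewrite -subset0 => v [w Cw _]; apply: C0; exists w.
right; exists (fun i v => if C (thead v) then o i (thead v) else o i w0).
  by move=> i; apply: recursive_if => //; exact: recursive_const.
apply/seteqP; split=> [_ [w Cw ->]|_ [w _ <-]].
  by exists w => //; apply: eq_from_tnth => i; rewrite !tnth_mktuple theadE Cw.
exists (if C w then w else w0); first by case: ifP.
by apply: eq_from_tnth => i; rewrite !tnth_mktuple theadE; case: ifP.
Qed.

(** If [u <= z] then [u < 2 ^ z], so digit [z] is 0. Hence [u] bounds any search through its own
    set. *)
Lemma canonical_finite_set_lt u z : canonical_finite_set u z -> z < u.
Proof.
rewrite /canonical_finite_set /= ltnNge; apply: contraTN => uz.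
by rewrite divn_small // (leq_ltn_trans uz) // ltn_expl.
Qed.

(** The index is built from its lowest binary digit [p 0] and, by induction, an index for the
    shifted predicate. *)
Lemma canonical_finite_set_ex N (p : pred nat) :
  exists u, forall z, canonical_finite_set u z <-> (z < N) && p z.
Proof.
elim: N p => [|N IH] p.
  by exists 0 => z; rewrite /canonical_finite_set /= div0n.
have [u uP] := IH (p \o succn); exists (p 0 + u.*2) => -[|z].
  by rewrite /canonical_finite_set /= divn1 oddD odd_double addbF oddb.
rewrite -[(z.+1 < _) && _]/((z < N) && (p \o succn) z) -uP.
rewrite /canonical_finite_set /= expnS divnMA divn2.
by rewrite (half_bit_double u (p 0)).
Qed.

Lemma coded_graphE f x y : coded_graph f (cantor_pair x y) <-> f x = Some y.
Proof.
split=> [[x' [y' [fx /[dup] /(congr1 cantor_fst) + /(congr1 cantor_snd)]]]|fx].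
  by rewrite !cantor_pair_fstK !cantor_pair_sndK => -> ->.
by exists x, y.
Qed.

(** [T] is obtained by classical choice; its effectivity will come from an enumerable set describing
    [G]. *)
Lemma operator_of_graph (G : partial_function -> nat -> nat -> Prop) :
  (forall f x y y', G f x y -> G f x y' -> y = y') ->
  exists T : partial_function -> partial_function,
    forall f x y, T f x = Some y <-> G f x y.
Proof.
move=> G_fun.
exists (fun f x => if pselect (exists y, G f x y) is left e
                   then Some (projT1 (cid e)) else None) => f x y.
case: pselect => [e|ne]; last by split=> // Gy; case: ne; exists y.
case: (cid e) => y' /= Gy'; split=> [[<-] //|/(G_fun _ _ _ _ Gy') -> //].
Qed.

Variables ci cm cj cn : nat -> nat.

(** [ci], [cm], [cj], [cn] are the components of an enumeration of quadruples, and [u] codes a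
    finite piece of the oracle's graph. The tested bit says that this piece contains the value
    [ci t] at [(cm t).+1]. *)
Definition hit u x t :=
  ((cn t).+1 == 2 ^ x.+1) && odd (u %/ 2 ^ cantor_pair (cm t).+1 (ci t)).

(* A positive certificate of failure, so that more information on the oracle
   cannot turn a rejected [t] into a hit. *)
Definition miss u x t :=
  ((cn t).+1 != 2 ^ x.+1) ||
  has (fun v => (v != ci t) && odd (u %/ 2 ^ cantor_pair (cm t).+1 v))
      (iota 0 u).

(** That no earlier index succeeds is certified by [u] alone, so the condition is decidable without
    the oracle. *)
Definition first_hit u x t := hit u x t && all (miss u x) (iota 0 t).

Definition search_goal (f : nat -> nat) x t :=
  ci t = f (cm t).+1 /\ (cn t).+1 = 2 ^ x.+1.

(** A hit records one value of [f] at [(cm t).+1], while a miss at the same precision records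
    another; the graph of [f] is single-valued. *)
Lemma hit_not_miss f u u' x t :
  canonical_finite_set u `<=` coded_graph f ->
  canonical_finite_set u' `<=` coded_graph f ->
  hit u x t -> ~~ miss u' x t.
Proof.
move=> uf u'f /andP[/eqP nt /uf /coded_graphE ft].
rewrite /miss nt eqxx /=; apply/hasPn => v _; apply/negP => /andP[/eqP vt].
by move=> /u'f /coded_graphE; rewrite ft => -[] /esym.
Qed.

(** Of two distinct indices, the smaller would be hit by its own certificate and missed by that of
    the larger. This makes the operator single-valued. *)
Lemma first_hit_unique f u u' x t t' :
  canonical_finite_set u `<=` coded_graph f ->
  canonical_finite_set u' `<=` coded_graph f ->
  first_hit u x t -> first_hit u' x t' -> t = t'.
Proof.
move=> uf u'f /andP[ht /allP mt] /andP[ht' /allP mt'].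
case: (ltngtP t t') => // [tt'|t't].
  by case/negP: (hit_not_miss uf u'f ht); apply: mt'; rewrite mem_iota.
by case/negP: (hit_not_miss u'f uf ht'); apply: mt; rewrite mem_iota.
Qed.

Lemma hit_search_goal f u x t :
  canonical_finite_set u `<=` coded_graph (fun k => Some (f k)) ->
  hit u x t -> search_goal f x t.
Proof. by move=> uf /andP[/eqP nt /uf /coded_graphE[ft]]. Qed.

Lemma first_hit_ex f x :
  (exists t, search_goal f x t) ->
  exists u t, canonical_finite_set u `<=` coded_graph (fun k => Some (f k)) /\
    first_hit u x t.
Proof.
move=> gx; have {}gx : exists t, `[< search_goal f x t >].
  by case: gx => t /asboolP; exists t.
case: (ex_minnP gx) => t /asboolP[it nt] min_t.
(* [g k] codes the oracle answer consulted at index [k]. Cutting the graph [p] of [f] just above all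
   [g k] with [k <= t] yields a finite set settling every index up to [t]. *)
pose g k := cantor_pair (cm k).+1 (f (cm k).+1).
pose p z := f (cantor_fst z) == cantor_snd z.
have [u uP] := canonical_finite_set_ex (\max_(k < t.+1) g k).+1 p.
have ug k : k <= t -> odd (u %/ 2 ^ g k).
  move=> kt; apply/uP; rewrite /p cantor_pair_fstK cantor_pair_sndK eqxx andbT.
  rewrite ltnS; have kt1 : k < t.+1 by [].
  exact: (leq_bigmax (F := fun k : 'I_t.+1 => g k) (Ordinal kt1)).
exists u, t; split=> [z /uP /andP[_ /eqP pz]|].
  exists (cantor_fst z), (cantor_snd z); split; first by rewrite pz.
  by rewrite cantor_pairK.
rewrite /first_hit /hit nt eqxx it ug //=.
apply/allP => k; rewrite mem_iota /= => kt.
(* The true oracle value refutes [k]: it is at most its code [g k], hence below [u], and it differs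
   from [ci k] because [t] is least. *)
rewrite /miss; case: eqP => //= nk; apply/hasP; exists (f (cm k).+1).
  rewrite mem_iota /= add0n.
  apply: leq_ltn_trans (canonical_finite_set_lt (ug k (ltnW kt))).
  exact: leq_addl.
rewrite ug ?(ltnW kt) // andbT; apply/eqP => ik.
have /min_t : `[< search_goal f x k >] by apply/asboolP.
by rewrite leqNgt kt.
Qed.

Hypotheses
  (rci : recursive (fun v : 1.-tuple nat => ci (thead v)))
  (rcm : recursive (fun v : 1.-tuple nat => cm (thead v)))
  (rcj : recursive (fun v : 1.-tuple nat => cj (thead v)))
  (rcn : recursive (fun v : 1.-tuple nat => cn (thead v))).

(** Both quantifiers are bounded: earlier indices by [t], conflicting values by [u]. *)
Lemma recursive_first_hit n (u x t : n.-tuple nat -> nat) :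
  recursive u -> recursive x -> recursive t ->
  recursive (fun v => first_hit (u v) (x v) (t v) : nat).
Proof.
have comp k (c : nat -> nat) (a : k.-tuple nat -> nat) :
    recursive (fun v : 1.-tuple nat => c (thead v)) -> recursive a ->
    recursive (fun v => c (a v)) by exact: recursive_app.
have rn k (y s : k.-tuple nat -> nat) : recursive y -> recursive s ->
    recursive (fun v => (cn (s v)).+1 == 2 ^ (y v).+1 : nat).
  move=> ry rs; apply: recursive_eqn; first exact/recursive_S/comp.
  exact/recursive_exp2/recursive_S.
move=> ru rx rt; apply: recursive_andb.
  apply: recursive_andb; first exact: rn.
  apply: recursive_bit ru _; apply: recursive_cantor_pair; last exact: comp.
  exact/recursive_S/comp.
apply: (recursive_all (p := fun s v => miss (u v) (x v) s)) rt.
have ru1 := recursive_behead ru; have rx1 := recursive_behead rx.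
have rs := recursive_thead n.
apply: recursive_orb; first exact/recursive_negb/rn.
apply: (recursive_has (p := fun v w => (v != ci (thead w)) &&
  odd (u [tuple of behead w] %/ 2 ^ cantor_pair (cm (thead w)).+1 v))) (ru1).
have ru2 := recursive_behead ru1.
have rs2 := recursive_behead rs; have rv := recursive_thead n.+1.
apply: recursive_andb.
  by apply/recursive_negb/recursive_eqn => //; exact: comp.
apply: recursive_bit => //; apply: recursive_cantor_pair => //.
exact/recursive_S/comp.
Qed.

Lemma oracle_search :
  exists2 T, recursive_operator T &
    forall f x, (exists t, search_goal f x t) ->
      exists2 t, search_goal f x t & T (fun k => Some (f k)) x = Some (cj t).
Proof.
(* The oracle [f] is an arbitrary partial function here, as a recursive operator must act on all of
   them. *)
pose G f x y := exists u t, [/\ first_hit u x t, y = cj t &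
  canonical_finite_set u `<=` coded_graph f].
have [|T TP] := @operator_of_graph G.
  move=> f x _ _ [u [t [ht -> uf]]] [u' [t' [ht' -> u'f]]].
  by rewrite (first_hit_unique uf u'f ht ht').
exists T; last first.
  move=> f x /first_hit_ex[u [t [uf ht]]]; exists t.
    by apply: hit_search_goal uf _; case/andP: ht.
  by apply/TP; exists u, t.
(* One number [w] codes [u], [x] and [t]; the enumerated triples are the outputs [o w] for the [w]
   accepted by the decidable test [C]. *)
pose o w := [tuple cantor_fst w; cantor_fst (cantor_snd w);
                   cj (cantor_snd (cantor_snd w))].
pose C w := first_hit (cantor_fst w) (cantor_fst (cantor_snd w))
                      (cantor_snd (cantor_snd w)).
have rw := recursive_thead 0.
have r1 := recursive_cantor_fst rw.
have r2 := recursive_cantor_fst (recursive_cantor_snd rw).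
have r3 := recursive_cantor_snd (recursive_cantor_snd rw).
exists [set v | exists2 w, C w & v = [tuple tnth (o w) i | i < 3]].
  apply: recursively_enumerable_image => [|i]; first exact: recursive_first_hit.
  by case: i => -[|[|[|//]]] lti //; exact: (recursive_app rcj).
move=> f x y; rewrite TP; split=> [[u [t [ht -> uf]]]|].
  exists u => //; exists (cantor_pair u (cantor_pair x t)).
    by rewrite /C !(cantor_pair_fstK, cantor_pair_sndK).
  apply: eq_from_tnth => i; rewrite tnth_mktuple /o.
  by rewrite !(cantor_pair_fstK, cantor_pair_sndK).
move=> [u [w Cw ow] uf]; exists u, (cantor_snd (cantor_snd w)).
move: ow uf; have -> : [tuple tnth (o w) i | i < 3] = o w.
  by apply: eq_from_tnth => i; rewrite tnth_mktuple.
by move=> /(congr1 val) [-> -> ->] uf; split.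
Qed.

End OracleSearch.

(** * Metric estimates for Cauchy names and approximation systems *)

Section CauchyNames.
Set Implicit Arguments.
Unset Strict Implicit.
Unset Printing Implicit Defensive.
Import Order.TTheory GRing.Theory Num.Theory.
Local Open Scope ring_scope.
Local Open Scope classical_set_scope.

(** Reading a name at [m.+1] rather than [m] gains strictness: [2 ^- m] equals [m.+1%:R^-1] for
    [m = 0] and [m = 1]. *)
Lemma ltr_expN2S (R : realType) (m : nat) : 2 ^- m.+1 < m.+1%:R^-1 :> R.
Proof.
by rewrite ltf_pV2 ?posrE ?exprn_gt0 ?ltr0n // -natrX ltr_nat ltn_expl.
Qed.

(** Passage to the limit in the Cauchy estimate, the distance from [x k] to [xi] being an
    arbitrarily small error [e]. *)
Lemma cauchy_name_dist (R : realType) (X : effective_metric_space R)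
    (xi : X) (x : nat -> X) (i : nat) :
  (forall k, (i < k)%N -> mdist (x i) (x k) <= 2 ^- i) ->
  x k @[k --> \oo] --> xi -> mdist (x i) xi <= 2 ^- i.
Proof.
move=> xC /metricType_numDomainType.cvgrPdist_lt cx; apply/ler_addgt0Pr => e e0.
near \oo => k; apply: le_trans (metric_triangle _ (x k) _) _.
apply: lerD; first by apply: xC; near: k; exact: nbhs_infty_gt.
by rewrite metric_sym ltW //; near: k; exact: cx.
Unshelve. all: by end_near. Qed.

(** The extra factor 1/2 pays for the triangle inequality through [xi]: for [i < k], both errors are
    at most [2 ^- i.+1]. *)
Lemma cauchy_name_of_dist (R : realType) (X : effective_metric_space R)
    (xi : X) (f : nat -> nat) :
  (forall i, exists2 a, ems_notation X (f i) = Some a &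
     mdist a xi < 2 ^- i.+1) ->
  cauchy_name xi f.
Proof.
move=> fP; have /choice[x xP] : forall i, exists a,
    ems_notation X (f i) = Some a /\ mdist a xi < 2 ^- i.+1.
  by move=> i; have [a] := fP i; exists a.
exists x; split=> [i|i k ik|]; first by have [] := xP i.
- apply: le_trans (metric_triangle _ xi _) _; rewrite (metric_sym xi).
  have -> : 2 ^- i = 2 ^- i.+1 + 2 ^- i.+1 :> R by rewrite exprS invfM; field.
  apply: lerD; apply: ltW; first by have [] := xP i.
  have [_ /lt_le_trans] := xP k; apply.
  by rewrite lef_pV2 ?posrE ?exprn_gt0 // ler_weXn2l ?ler1n // ltnW.
- apply/metricType_numDomainType.cvgrPdist_lt => e e0.
  near=> i; rewrite metric_sym; have [_ /lt_trans] := xP i; apply.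
  apply: (@lt_trans _ _ (2 ^- i)).
    by rewrite ltf_pV2 ?posrE ?exprn_gt0 // ltr_eXn2l // ltr1n.
  rewrite -[2 ^- i]mul1r.
  near: i; exact: (near_infty_natSinv_expn_lt (PosNum e0)).
Unshelve. all: by end_near. Qed.

(** The search succeeds: condition (2) fixes [m] before the point [a] is chosen, so the name can be
    read at [m.+1]. *)
Lemma approximation_search (R : realType) (X Y : effective_metric_space R)
    (D : set X) (theta : D -> Y) (S : set (X * nat * Y * nat))
    (xi : D) (f : nat -> nat) (n : nat) :
  approximation_system theta S -> cauchy_name (val xi) f ->
  exists m j, approximation_codes S [tuple f m.+1; m; j; n].
Proof.
move=> [SAB /(_ xi)[_ /(_ n)[m mP]]] [x [fx xC cx]].
have xA : ems_set (x m.+1) by apply/ems_notation_onto; exists (f m.+1).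
have [|b Sb] := mP _ xA.
  by apply: le_lt_trans (cauchy_name_dist (xC m.+1) cx) (ltr_expN2S R m).
have [_ /ems_notation_onto[j jb]] := SAB _ _ _ _ Sb.
by exists m, j, (f m.+1), m, j, n, (x m.+1), b.
Qed.

(** The point coded by [f m.+1] is close enough for condition (1) whatever [m] is, so this covers
    any quadruple the search meets first. *)
Lemma approximation_sound (R : realType) (X Y : effective_metric_space R)
    (D : set X) (theta : D -> Y) (S : set (X * nat * Y * nat))
    (xi : D) (f : nat -> nat) (m j n : nat) :
  approximation_system theta S -> cauchy_name (val xi) f ->
  approximation_codes S [tuple f m.+1; m; j; n] ->
  exists2 b, ems_notation Y j = Some b & mdist b (theta xi) < n.+1%:R^-1.
Proof.
move=> [_ /(_ xi)[SD _]] [x [fx xC cx]] [i' [m' [j' [n' [a [b []]]]]]].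
move=> /(congr1 val)[<- <- <- <-]; rewrite fx => -[<-] jb /SD ab.
exists b => //; apply: ab.
exact: le_lt_trans (cauchy_name_dist (xC m.+1) cx) (ltr_expN2S R m).
Qed.

End CauchyNames.

Theorem theorem2 (R : realType) (X Y : effective_metric_space R)
    (D : set X) (theta : D -> Y) (S : set (X * nat * Y * nat)) :
  approximation_system theta S ->
  recursively_enumerable (approximation_codes S) ->
  computable theta.
Proof.
move=> SP [S0|[h rh hS]].
  (* With nothing enumerated, a name of a point of [D] would contradict the success of the search,
     so the nowhere defined operator works vacuously. *)
  exists (fun _ _ => None).
    by exists set0; [left | move=> f x y; split=> [//|[]]].
  by move=> xi f /(approximation_search 0 SP)[m [j]]; rewrite S0.
pose c (i : 'I_4) (t : nat) := h i [tuple t].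
have rc i : recursive (fun v : 1.-tuple nat => c i (thead v)).
  by apply: recursive_app (rh i) _; exact: recursive_thead.
pose o k : 'I_4 := inord k.
have cE t : [tuple h i [tuple t] | i < 4] =
    [tuple c (o 0) t; c (o 1) t; c (o 2) t; c (o 3) t].
  apply: eq_from_tnth => i; rewrite tnth_mktuple /c.
  by case: i => -[|[|[|[|//]]]] lti; congr (h _ _);
    apply: val_inj; rewrite /= inordK.
have [T rT TP] := oracle_search (rc (o 0)) (rc (o 1)) (rc (o 2)) (rc (o 3)).
exists T => // xi f fxi.
have /choice[g gP] : forall i, exists y,
    T (fun k => Some (f k)) i = Some y /\
    exists2 b, ems_notation Y y = Some b & (mdist b (theta xi) < 2 ^- i.+1)%R.
  move=> i; have [|t [ft nt] Tt] := TP f i.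
    (* This [n] satisfies [n.+1 = 2 ^ i.+1], turning the bound of condition (1) into [2 ^- i.+1]. *)
    have [m [j]] := approximation_search (2 ^ i.+1).-1 SP fxi.
    rewrite hS => -[t _]; rewrite cE => /(congr1 val)[ft mt _ nt].
    by exists t; rewrite /search_goal ft mt nt prednK // expn_gt0.
  exists (c (o 2) t); split=> //.
  (* The operator's [t] may differ from the index just exhibited, so soundness is applied to the
     quadruple at [t] itself. *)
  have : approximation_codes S
      [tuple c (o 0) t; c (o 1) t; c (o 2) t; c (o 3) t].
    by rewrite hS -cE; exists t.
  by rewrite ft => /(approximation_sound SP fxi); rewrite nt GRing.natrX.
exists g => [i|]; first by have [] := gP i.
by apply: cauchy_name_of_dist => i; have [] := gP i.
Qed.
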